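(* Let $G=(V,E)$ be a finite graph, $\mathcal{S}=\{S_i\}_{i\in V}$ a scale on $G$ with dual scale $\overline{\mathcal{S}}=\{\overline{S}_i\}_{i\in V}$, and let $n=|V|$, $m=|E|$, $l=|V|\cdot|E|$. Let $F\subset\mathbb{R}^n\times\mathbb{R}^m\times\mathbb{R}^l$ be the set of admissible solutions $(\eta,\kappa,\varphi)$ of the pseudo-flow problem at dual scale $\overline{\mathcal{S}}$ and $K\subset\mathbb{R}^n\times\mathbb{R}^m$ the set of admissible solutions $(\eta,\kappa)$ of the weighted isoperimetric inequalities problem at scale $\overline{\mathcal{S}}$ (both written out in the context). Then the projection $$\pi\colon\mathbb{R}^n\times\mathbb{R}^m\times\mathbb{R}^l\to\mathbb{R}^n\times\mathbb{R}^m,\qquad(\eta,\kappa,\varphi)\mapsto(\eta,\kappa),$$ maps $F$ onto $K$, i.e. for each $\eta$ and $\kappa$ that satisfy the weighted isoperimetric inequalities there exists a family of flows $\varphi_k$, $k\in V$, that satisfies demand $\eta$ under capacity $\kappa$.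
   Context: A graph $G=(V,E)$ is oriented, with $E\subset V\times V$ and no self-loops; $ij\in E$ denotes an edge with initial vertex $i$ and terminal vertex $j$. A scale on $G$ is a family $\mathcal{S}=\{S_i\}_{i\in V}$ of subsets of $V$; its dual scale is $\overline{\mathcal{S}}=\{\overline{S}_i\}_{i\in V}$ with $\overline{S}_i=\{j\in V: i\in S_j\}$. For $T\subset V$ the edge boundary is $\partial T=\big((T\times(V\setminus T))\cup((V\setminus T)\times T)\big)\cap E$. Coordinates: $\eta=(\eta_i)_{i\in V}$, $\kappa=(\kappa_{ij})_{ij\in E}$, $\varphi=(\varphi_{k,ij})_{k\in V,\,ij\in E}$; write $\varphi_k=(\varphi_{k,ij})_{ij\in E}$. $F$ is the set of $(\eta,\kappa,\varphi)$ with $\sum_{ij\in E}\kappa_{ij}\le 1$; $-\kappa_{ij}\le\varphi_{k,ij}\le\kappa_{ij}$ for all $ij\in E$, $k\in V$; and $\sigma_{k,i}\ge\eta_i$ for all $k\in V$, $i\in\overline{S}_k$, where $$\sigma_{k,i}=\sum_{m\in V:\,mi\in E}\varphi_{k,mi}-\sum_{m\in V:\,im\in E}\varphi_{k,im}.$$ $K$ is the set of $(\eta,\kappa)$ with $\sum_{ij\in E}\kappa_{ij}\le 1$; $\sum_{i\in T}\eta_i\le\sum_{ij\in\partial T}\kappa_{ij}$ for every $T\subset V$ contained in some $\overline{S}\in\overline{\mathcal{S}}$; and $\kappa_{ij}\ge 0$ for all $ij\in E$. *)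

(* Defs.v *)
From mathcomp Require Import all_boot all_order all_algebra.
From mathcomp Require Import boolp classical_sets reals.

Set Implicit Arguments.
Unset Strict Implicit.
Unset Printing Implicit Defensive.

Import Order.TTheory GRing.Theory Num.Theory.
Local Open Scope ring_scope.

Definition loopless (V : finType) (E : {set V * V}) : Prop :=
  forall i : V, (i, i) \notin E.

Notation edge E := {e | e \in E}.

Definition source (V : finType) (E : {set V * V}) (e : edge E) : V := (sval e).1.
Definition target (V : finType) (E : {set V * V}) (e : edge E) : V := (sval e).2.

Definition scale (V : finType) : Type := V -> {set V}.

Definition dual_scale (V : finType) (S : scale V) : scale V :=
  fun i => [set j : V | i \in S j]%SET.

Definition edge_boundary (V : finType) (E : {set V * V}) (T : {set V}) :
    {set V * V} :=
  ((finset.setX T (~: T) :|: finset.setX (~: T) T) :&: E)%SET.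

Section Problems.
Variables (R : realType) (V : finType) (E : {set V * V}).

Definition vertex_space : Type := {ffun V -> R}.
Definition edge_space : Type := {ffun edge E -> R}.
Definition flow_space : Type := {ffun V * edge E -> R}.

(* Net inflow at [i] of the [k]-th flow; since [E] is a set of pairs, the edges
   with target [i] are exactly the [mi] in [E], one for each such [m]. *)
Definition net_inflow (phi : flow_space) (k i : V) : R :=
  \sum_(e : edge E | target e == i) phi (k, e)
  - \sum_(e : edge E | source e == i) phi (k, e).

(* In both problems the family [D] is the dual scale itself. *)
Definition pseudo_flow_set (D : scale V) :
    set (vertex_space * edge_space * flow_space) :=
  fun x => let: (eta, kappa, phi) := x in
    [/\ \sum_(e : edge E) kappa e <= 1,
        forall (e : edge E) (k : V), - kappa e <= phi (k, e) <= kappa e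
      & forall k i : V, i \in D k -> eta i <= net_inflow phi k i].

Definition isoperimetric_set (D : scale V) : set (vertex_space * edge_space) :=
  fun x => let: (eta, kappa) := x in
    [/\ \sum_(e : edge E) kappa e <= 1,
        forall T : {set V}, (exists k : V, T \subset D k) ->
          \sum_(i in T) eta i
            <= \sum_(e : edge E | sval e \in edge_boundary E T) kappa e
      & forall e : edge E, 0 <= kappa e].

Definition forget_flow (x : vertex_space * edge_space * flow_space) :
    vertex_space * edge_space :=
  let: (eta, kappa, phi) := x in (eta, kappa).

End Problems.

(* Main.v *)
Require Import Defs.
From mathcomp Require Import all_boot all_order all_algebra.
From mathcomp Require Import boolp classical_sets reals.
From mathcomp Require Import lra.

(** Summing the demand inequalities over [T] makes the flow on edges inside [T]
    cancel, so only boundary edges contribute, each at most its capacity: this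
    is the easy inclusion ([le_net_in_cut]).

    For the converse the flows with different indices [k] do not interact, so
    one builds, for a single vertex set [D], a flow under the given capacities
    which meets the demand on [D] as soon as no [T] inside [D] demands more than
    the capacity of its cut ([demand_flow]).  The edges are removed one at a
    time.  Sending an amount [x] along the edge [e] from [u] to [v] lowers the
    demand at [v] and raises the one at [u] by [x], leaving the same problem
    without [e].  Its cut conditions bound [x] from below through the sets [T]
    that contain [v] but not [u], and from above through those that contain [u]
    but not [v]; the capacity of [e] bounds [x] on both sides.  A suitable [x]
    exists when every lower bound is at most every upper bound.  The only case
    that is not immediate pairs a lower bound from [A] with an upper bound from
    [B]: since [e] crosses neither [A :|: B] nor [A :&: B], it follows from the
    original conditions at these two sets and the submodularity of the cut
    function ([cut_submodular]).  Once no edge is left, the condition at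
    singletons says that no demand on [D] is positive. *)

Set Implicit Arguments.
Unset Strict Implicit.
Unset Printing Implicit Defensive.

Import Order.TTheory GRing.Theory Num.Theory.
Local Open Scope ring_scope.

Section Flow.
Variables (R : realFieldType) (V : finType) (X : eqType) (s t : X -> V).
Implicit Types (r : seq X) (c phi : X -> R) (eta : V -> R) (T D : {set V}).

Definition crosses e T : bool := (s e \in T) (+) (t e \in T).

Definition cut r c T : R := \sum_(e <- r | crosses e T) c e.

Definition net_in r phi i : R :=
  \sum_(e <- r | t e == i) phi e - \sum_(e <- r | s e == i) phi e.

Lemma cut_mkcond r c T :
  cut r c T = \sum_(e <- r) if crosses e T then c e else 0.
Proof. exact: big_mkcond. Qed.

Lemma sum_delta T (j : V) (x : R) :
  \sum_(i in T) (if j == i then x else 0) = if j \in T then x else 0.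
Proof.
rewrite -big_mkcondr /=; case: ifPn => jT.
  rewrite (big_pred1 j) // => i /=; rewrite eq_sym.
  by case: eqP => [->|]; rewrite ?jT ?andbF.
by rewrite big_pred0 // => i; case: eqP => [<-|]; rewrite ?(negPf jT) ?andbF.
Qed.

Lemma sum_net_in r phi T :
  \sum_(i in T) net_in r phi i =
  \sum_(e <- r) ((if t e \in T then phi e else 0)
                 - (if s e \in T then phi e else 0)).
Proof.
have sum_fiber (f : X -> V) : \sum_(i in T) \sum_(e <- r | f e == i) phi e
    = \sum_(e <- r) (if f e \in T then phi e else 0).
  under eq_bigr do rewrite big_mkcond /=.
  by rewrite exchange_big; apply: eq_bigr => e _; rewrite sum_delta.
by rewrite !sumrB !sum_fiber.
Qed.

(** An edge inside [T] enters the sum once with each sign, so its flow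
    cancels. *)
Lemma le_net_in_cut r c phi T :
  (forall e, - c e <= phi e <= c e) ->
  \sum_(i in T) net_in r phi i <= cut r c T.
Proof.
move=> phi_c; rewrite sum_net_in cut_mkcond.
apply: ler_sum => e _; rewrite /crosses; move/andP: (phi_c e) => [lo hi].
by case: (s e \in T); case: (t e \in T) => /=; lra.
Qed.

(** Edge by edge: an edge that crosses the union or the intersection crosses
    [A] or [B], and one that crosses both of the former crosses both [A] and
    [B]. *)
Lemma cut_submodular r c A B : (forall e, 0 <= c e) ->
  cut r c (A :|: B) + cut r c (A :&: B) <= cut r c A + cut r c B.
Proof.
move=> c_ge0; rewrite !cut_mkcond -!big_split /=.
apply: ler_sum => e _; rewrite /crosses !inE; have := c_ge0 e.
by case: (s e \in A); case: (t e \in A); case: (s e \in B); case: (t e \in B)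
  => /= ?; lra.
Qed.

Lemma cut_cons e r c T :
  cut (e :: r) c T = (if crosses e T then c e else 0) + cut r c T.
Proof. by rewrite /cut big_cons; case: ifP; rewrite ?add0r. Qed.

Lemma sum_setUI eta A B :
  \sum_(i in A :|: B) eta i + \sum_(i in A :&: B) eta i
  = \sum_(i in A) eta i + \sum_(i in B) eta i.
Proof.
have mkcond T : \sum_(i in T) eta i = \sum_i if i \in T then eta i else 0.
  exact: big_mkcond.
rewrite !mkcond -!big_split /=; apply: eq_bigr => i _.
by rewrite !inE; case: (i \in A); case: (i \in B) => /=; lra.
Qed.

(** Demand left over for the other edges once the edge [e] carries [x]. *)
Definition residual eta e (x : R) i : R :=
  eta i - (if t e == i then x else 0) + (if s e == i then x else 0).

Lemma sum_residual eta e x T :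
  \sum_(i in T) residual eta e x i =
  \sum_(i in T) eta i - (if t e \in T then x else 0)
  + (if s e \in T then x else 0).
Proof. by rewrite big_split sumrB !sum_delta. Qed.

(** The amount chosen is the largest of the lower bounds: the negated capacity
    of [e], and the excess demand of each [T] which [e] enters.  Every such
    bound is at most the upper bound coming from any set which [e] leaves,
    through submodularity when both bounds come from sets. *)
Lemma exists_edge_amount e r c eta D :
  (forall e, 0 <= c e) ->
  (forall T, T \subset D -> \sum_(i in T) eta i <= cut (e :: r) c T) ->
  exists2 x, - c e <= x <= c e &
    forall T, T \subset D -> \sum_(i in T) residual eta e x i <= cut r c T.
Proof.
move=> c_ge0 cut_eta; have ce := c_ge0 e.
pose P T := [&& T \subset D, t e \in T & s e \notin T].
pose a T := \sum_(i in T) eta i - cut r c T.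
pose x := \big[Num.max/- c e]_(T | P T) a T.
have a_le_x T : P T -> a T <= x by move=> PT; apply: le_bigmax_cond.
have x_ge : - c e <= x by apply: bigmax_ge_id.
have x_le : x <= c e.
  apply: bigmax_le => [|T /and3P[TD tT sT]]; first by lra.
  by have := cut_eta T TD; rewrite cut_cons /crosses tT (negPf sT) /a /=; lra.
exists x => [|T TD]; first by rewrite x_ge x_le.
rewrite sum_residual; have := cut_eta T TD; rewrite cut_cons /crosses.
case: (boolP (t e \in T)) => tT; case: (boolP (s e \in T)) => sT /= cutT;
  [lra | | | lra].
  by have := a_le_x T; rewrite /P TD tT sT /a => /(_ isT); lra.
(* The edge [e] leaves [T]: this is where [T] bounds [x] from above. *)
suff : x <= cut r c T - \sum_(i in T) eta i by lra.
apply: bigmax_le => [|A /and3P[AD tA sA]]; first by lra.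
(* [e] crosses neither the union nor the intersection, so the conditions there
   do not involve [c e]. *)
have AUTD : A :|: T \subset D by rewrite finset.subUset AD TD.
have AITD : A :&: T \subset D by apply: (fintype.subset_trans _ AD); apply: finset.subsetIl.
have := cut_eta _ AUTD; have := cut_eta _ AITD.
rewrite !cut_cons /crosses !inE tA sT (negPf sA) (negPf tT) /= !add0r.
by have := sum_setUI eta A T; have := cut_submodular r A T c_ge0; rewrite /a; lra.
Qed.

(** A max-flow min-cut statement for demands.  The edges are listed without
    repetition so that setting the flow on the first one leaves the flow found
    for the others unchanged. *)
Lemma demand_flow r c eta D : uniq r ->
  (forall e, 0 <= c e) ->
  (forall T, T \subset D -> \sum_(i in T) eta i <= cut r c T) ->
  exists2 phi : X -> R, (forall e, - c e <= phi e <= c e) &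
    forall i, i \in D -> eta i <= net_in r phi i.
Proof.
move=> + c_ge0; elim: r eta => [|e r IHr] eta /=.
  move=> _ cut_eta; exists (fun=> 0) => [e|i iD].
    by have := c_ge0 e; lra.
  have := cut_eta [set i]%SET; rewrite finset.sub1set big_set1 /cut /net_in !big_nil.
  by rewrite subr0; apply.
case/andP=> er ur cut_eta.
have [x x_c cut_res] := exists_edge_amount c_ge0 cut_eta.
have [phi phi_c phi_eta] := IHr _ ur cut_res.
exists (fun e' => if e' == e then x else phi e') => [e'|i iD].
  by case: eqP => [->|_].
have off_e (Q : pred X) : \sum_(e' <- r | Q e') (if e' == e then x else phi e')
    = \sum_(e' <- r | Q e') phi e'.
  rewrite big_seq_cond [RHS]big_seq_cond; apply: eq_bigr => e' /andP[e'r _].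
  by case: eqP e'r => // ->; rewrite (negPf er).
have := phi_eta i iD; rewrite /residual /net_in !big_cons !off_e eqxx.
by case: (t e == i); case: (s e == i); lra.
Qed.

End Flow.

Section EdgeSet.
Variables (R : realType) (V : finType) (E : {set V * V}).

Lemma mem_edge_boundary (e : edge E) (T : {set V}) :
  (sval e \in edge_boundary E T) = crosses (@source V E) (@target V E) e T.
Proof.
rewrite /crosses /source /target; case: e => -[u v] uvE /=.
by rewrite !inE uvE /=; case: (u \in T); case: (v \in T).
Qed.

Lemma cut_edge_boundary (kappa : edge_space R E) (T : {set V}) :
  \sum_(e : edge E | sval e \in edge_boundary E T) kappa e =
  cut (@source V E) (@target V E) (index_enum _) kappa T.
Proof. by apply: eq_bigl => e; rewrite mem_edge_boundary. Qed.

End EdgeSet.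

Theorem theorem5p1 (R : realType) (V : finType) (E : {set V * V})
    (hE : loopless E) (S : scale V) :
  (@forget_flow R V E @` pseudo_flow_set (dual_scale S)
   = isoperimetric_set (dual_scale S))%classic.
Proof.
apply/seteqP; split => [_ [[[eta kappa] phi] [sum_k phi_k phi_eta] <-]|].
  split=> // [T [k TD]|e].
    rewrite cut_edge_boundary.
    apply: le_trans (@le_net_in_cut R V _ (@source V E) (@target V E)
      (index_enum _) kappa (fun e => phi (k, e)) T (phi_k^~ k)).
    by apply: ler_sum => i iT; apply: phi_eta; apply: (fintype.subsetP TD).
  (* Any flow [k] forces [0 <= kappa e]; the source of [e] provides a vertex to
     use as [k]. *)
  by have := phi_k e (source e); lra.
move=> [eta kappa] [sum_k cut_eta k_ge0].
have flow k : exists phi : edge E -> R,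
    (forall e, - kappa e <= phi e <= kappa e) /\
    forall i, i \in dual_scale S k ->
      eta i <= net_in (@source V E) (@target V E) (index_enum _) phi i.
  have [|phi ? ?] := @demand_flow R V _ (@source V E) (@target V E) _ _ eta
      (dual_scale S k) (index_enum_uniq _) k_ge0; last by exists phi.
  by move=> T TD; rewrite -cut_edge_boundary; apply: cut_eta; exists k.
have [phi phiP] := choice flow.
exists (eta, kappa, [ffun ke => phi ke.1 ke.2]) => //; split=> // [e k|k i iD].
  by rewrite ffunE; apply: (phiP k).1.
rewrite /net_inflow; under eq_bigr do rewrite ffunE /=.
under [X in _ - X]eq_bigr do rewrite ffunE /=.
exact: (phiP k).2.
Qed.
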